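(* Consider solutions of the steady stream function equation $$-\rho\,\{\psi,\nabla^2\psi\}=\mu\nabla^4\psi-\alpha_1\{\psi,\nabla^4\psi\}-\left(H+\frac{\mu}{K}\right)\nabla^2\psi$$ of the form $\psi(x,y)=\xi(x)+\eta(y)$ with $\xi(x)=Ax+Be^{ax}$, $\eta(y)=Cy+De^{by}$, where $A,B,C,D,a,b$ are constants. Substitution leads to the three conditions $$\rho aC=\mu a^2+\alpha_1a^3C-H-\frac{\mu}{K},\qquad -\rho bA=\mu b^2-\alpha_1b^3A-H-\frac{\mu}{K},\qquad (b^2-a^2)\left[\rho-\alpha_1(a^2+b^2)\right]=0 ,$$ so that $A=-\overline{b}$ and $C=\overline{a}$, where $$\overline{a}=\frac{1}{\rho-\alpha_1a^2}\left[\mu a-\frac{H}{a}-\frac{\mu}{Ka}\right],\qquad \overline{b}=\frac{1}{\rho-\alpha_1b^2}\left[\mu b-\frac{H}{b}-\frac{\mu}{Kb}\right],$$ and either $b^2=a^2$ or $\rho=\alpha_1(a^2+b^2)$. With $B,D$ arbitrary constants, $p_0$ a constant, and $W$ the product logarithm, the stream function $\psi$, the velocity components $u,v$, the pressure field $p$ (obtained by integrating the momentum equations given in the context) and the streamline $\psi=\Omega$ ($\Omega$ constant) are as follows in the three resulting cases. Case 1: $b=a$, $\rho\neq\alpha_1(a^2+b^2)$. Then $$\psi=\overline{a}\,(y-x)+Be^{ax}+De^{ay},\qquad u=\overline{a}+Da\,e^{ay},\qquad v=\overline{a}-Ba\,e^{ax},$$ $$p=p_0-\rho\overline{a}^2-\mu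 Ba^3y\,e^{ax}+(\rho-\alpha_1a^2)\left[a^2By\,e^{ax}+a^2DB\,e^{a(x+y)}\right]+\alpha_1\left[B^2a^4e^{2ax}+D^2a^4e^{2ay}-DBa^4e^{a(x+y)}\right],$$ and the streamline $\psi=\Omega$ is $$y=\frac{-Be^{ax}+\overline{a}x+\Omega}{\overline{a}}-\frac1a\,W\!\left[\frac{Da}{\overline{a}}\,e^{a(-Be^{ax}+\overline{a}x+\Omega)/\overline{a}}\right].$$ Case 2: $b=-a$, $\rho\neq\alpha_1(a^2+b^2)$. Then $$\psi=\overline{a}\,(y+x)+Be^{ax}+De^{-ay},\qquad u=\overline{a}-Da\,e^{-ay},\qquad v=-\overline{a}-Ba\,e^{ax},$$ $$p=p_0-\rho\overline{a}^2-\mu Ba^3y\,e^{ax}+(\rho-\alpha_1a^2)\left[a^2By\,e^{ax}+a^2DB\,e^{a(x-y)}\right]+\alpha_1\left[B^2a^4e^{2ax}+D^2a^4e^{-2ay}-DBa^4e^{a(x-y)}\right],$$ and the streamline $\psi=\Omega$ is $$y=\frac{-Be^{ax}-\overline{a}x+\Omega}{\overline{a}}+\frac1a\,W\!\left[-\frac{Da}{\overline{a}}\,e^{a(Be^{ax}+\overline{a}x-\Omega)/\overline{a}}\right].$$ Case 3: $b^2-a^2\neq0$, so that necessarily $\rho=\alpha_1(a^2+b^2)$. Then $$\psi=-\overline{b}\,x+\overline{a}\,y+Be^{ax}+De^{by},\qquad u=\overline{a}+Db\,e^{by},\qquad v=\overline{b}-Ba\,e^{ax},$$ $$p=p_0-\tfrac12\rho\left[\overline{a}^2+\overline{b}^2\right]-\mu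 Ba^3y\,e^{ax}+(\rho-\alpha_1a^2)\left[a^2By\,e^{ax}+a^2DB\,e^{ax+by}\right]+\alpha_1\left[B^2a^4e^{2ax}+D^2a^4e^{2by}-DBa^4b^2e^{ax+by}\right],$$ and the streamline $\psi=\Omega$ is $$y=-\frac{Be^{ax}-\overline{b}x-\Omega}{\overline{a}}-\frac1b\,W\!\left[\frac{Db}{\overline{a}}\,e^{-b(Be^{ax}-\overline{b}x-\Omega)/\overline{a}}\right].$$ In Case 3 the stream function may alternatively be written $$\psi=-\overline{b}\,x+\frac{y}{\alpha_1b^2}\left[\mu a-\frac{H}{a}-\frac{\mu}{Ka}\right]+Be^{ax}+De^{by}$$ or $$\psi=-\frac{x}{\alpha_1a^2}\left[\mu b-\frac{H}{b}-\frac{\mu}{Kb}\right]+\overline{a}\,y+Be^{ax}+De^{by}.$$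
   Context: This concerns steady plane flow of an incompressible second-grade fluid in a porous medium with Hall currents. Here $\rho$ is the density, $\mu\ge0$ the viscosity, $\alpha_1$ the second-grade material constant (both signs are considered), and $K$ the permeability of the porous medium. The constant $H=\dfrac{\sigma\mathbf{B}_0^2(1+i\varphi)}{1+\varphi^2}$, where $\sigma$ is the electrical conductivity, $\mathbf{B}_0$ the magnetic field strength and $\varphi$ the Hall parameter. Further, $\nabla^2=\partial_x^2+\partial_y^2$, $\nabla^4=\nabla^2\nabla^2$, and $\{f,g\}=\dfrac{\partial f}{\partial x}\dfrac{\partial g}{\partial y}-\dfrac{\partial f}{\partial y}\dfrac{\partial g}{\partial x}$. The velocity components are $u=\partial\psi/\partial y$, $v=-\partial\psi/\partial x$, and the vorticity is $\omega=\partial v/\partial x-\partial u/\partial y$. The pressure $p$ is determined through the steady momentum equations $$\frac{\partial\widehat p}{\partial x}-\rho v\omega=\mu\nabla^2u-\alpha_1v\nabla^2\omega-Hu-\frac{\mu}{K}u,\qquad \frac{\partial\widehat p}{\partial y}+\rho u\omega=\mu\nabla^2v+\alpha_1u\nabla^2\omega-Hv-\frac{\mu}{K}v,$$ where $$\widehat p=p+\tfrac12\rho(u^2+v^2)-\alpha_1\left[u\nabla^2u+v\nabla^2v+\tfrac14\left(4u_x^2+4v_y^2+2(u_y+v_x)^2\right)\right].$$ The product logarithm $W$ satisfies $W(z)e^{W(z)}=z$. All constants are taken so that the denominators displayed are nonzero.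
   Formalization: Pressure corrected: -(H+μ/K)(āx+b̄y-Bay e^{ax}) added in all cases (b̄=±ā in Cases 1, 2); a²By e^{ax} gains factor ā; in Case 3 D²a⁴ becomes D²b⁴ and DBa⁴b² becomes DBa²b². That solutions must satisfy the three conditions is claimed only for B, D nonzero. *)

(* Defs.v *)
From Stdlib Require Import Reals.
From Coquelicot Require Import Coquelicot.
Open Scope C_scope.

(* The Hall constant is complex, so every field of the flow is a complex-valued
   function of the two real coordinates, and the constants of the solution are
   complex numbers. *)
Definition field := R -> R -> C.

Definition cexp (z : C) : C := (exp (Re z) * cos (Im z), exp (Re z) * sin (Im z))%R.

(* Partial derivatives, taken on real and imaginary parts.  [Derive] is total:
   the value is only meaningful where the derivatives exist. *)
Definition dx (f : field) : field := fun x y =>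
  (Derive (fun t => Re (f t y)) x, Derive (fun t => Im (f t y)) x).
Definition dy (f : field) : field := fun x y =>
  (Derive (fun t => Re (f x t)) y, Derive (fun t => Im (f x t)) y).

Definition lap (f : field) : field := fun x y => dx (dx f) x y + dy (dy f) x y.

Definition jac (f g : field) : field := fun x y =>
  dx f x y * dy g x y - dy f x y * dx g x y.

Record fluid := Fluid {
  rho : R;     (* density *)
  mu : R;      (* viscosity *)
  alpha1 : R;  (* second-grade material constant *)
  perm : R;    (* permeability of the porous medium *)
  sigma : R;   (* electrical conductivity *)
  B0 : R;      (* magnetic field strength *)
  phi : R      (* Hall parameter *)
}.

Definition Hall (F : fluid) : C :=
  sigma F * B0 F ^ 2 * (1 + Ci * phi F) / (1 + phi F ^ 2).

Definition stream_equation (F : fluid) (psi : field) : Prop := forall x y : R,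
  - rho F * jac psi (lap psi) x y
  = mu F * lap (lap psi) x y - alpha1 F * jac psi (lap (lap psi)) x y
    - (Hall F + mu F / perm F) * lap psi x y.

Definition vel_u (psi : field) : field := dy psi.
Definition vel_v (psi : field) : field := fun x y => - dx psi x y.
Definition vorticity (psi : field) : field := fun x y =>
  dx (vel_v psi) x y - dy (vel_u psi) x y.

Definition modified_pressure (F : fluid) (psi p : field) : field := fun x y =>
  let u := vel_u psi in let v := vel_v psi in
  p x y + / 2 * rho F * (u x y ^ 2 + v x y ^ 2)
  - alpha1 F *
    (u x y * lap u x y + v x y * lap v x y
     + / 4 * (4 * dx u x y ^ 2 + 4 * dy v x y ^ 2
              + 2 * (dy u x y + dx v x y) ^ 2)).

(* [p] is a pressure for the flow with stream function [psi]: it has partial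
   derivatives everywhere and satisfies the two steady momentum equations. *)
Definition is_pressure (F : fluid) (psi p : field) : Prop :=
  let u := vel_u psi in let v := vel_v psi in let w := vorticity psi in
  let P := modified_pressure F psi p in
  forall x y : R,
  ex_derive (V := C_R_NormedModule) (fun t => p t y) x /\
  ex_derive (V := C_R_NormedModule) (fun t => p x t) y /\
  dx P x y - rho F * v x y * w x y
    = mu F * lap u x y - alpha1 F * v x y * lap w x y
      - Hall F * u x y - mu F / perm F * u x y /\
  dy P x y + rho F * u x y * w x y
    = mu F * lap v x y + alpha1 F * u x y * lap w x y
      - Hall F * v x y - mu F / perm F * v x y.

Definition ansatz (A B C0 D a b : C) : field := fun x y =>
  (A * x + B * cexp (a * x)) + (C0 * y + D * cexp (b * y)).

Definition conditions (F : fluid) (A C0 a b : C) : Prop :=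
  rho F * a * C0
    = mu F * a ^ 2 + alpha1 F * a ^ 3 * C0 - Hall F - mu F / perm F /\
  - rho F * b * A
    = mu F * b ^ 2 - alpha1 F * b ^ 3 * A - Hall F - mu F / perm F /\
  (b ^ 2 - a ^ 2) * (rho F - alpha1 F * (a ^ 2 + b ^ 2)) = 0.

(* Both constants written with an overline are values of this one function. *)
Definition bar (F : fluid) (c : C) : C :=
  1 / (rho F - alpha1 F * c ^ 2)
  * (mu F * c - Hall F / c - mu F / (perm F * c)).

(* The product logarithm is multivalued: [product_log z w] says that [w] is one
   of its values at [z]. *)
Definition product_log (z w : C) : Prop := w * cexp w = z.

(* Main.v *)
Require Import Defs.
From Stdlib Require Import Reals Classical FunctionalExtensionality.
From Coquelicot Require Import Coquelicot.
Open Scope C_scope.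

(** With E = e^(ax) and G = e^(by), every field built from psi by derivatives
    is of the form
    k + A x + B E + C0 y + D G, on which the partial derivatives act by an
    explicit rule on the coefficients ([dx_wave], [dy_wave]).  The difference of the two sides of
    the stream function equation is therefore a combination of E, G and EG, and the
    three coefficients are, up to factors a^2 B, b^2 D and -abBD, the defects of
    the three conditions ([stream_equation_defects]).  Since E and G are
    nonconstant functions of different variables, E, G and EG are linearly
    independent, which gives the converse when B and D are nonzero.  The first two defects
    are affine in C0 and A, and solving them gives the bar constants
    ([bar_of_condition]).

    For the pressure, modulo the three defects the momentum equations say
    that p has the gradient of the explicit function
    alpha1 (a^4 B^2 E^2 + b^4 D^2 G^2) + a^2 (rho - alpha1 (a^2 + b^2)) BD EG
    - h (C0 x - A y), with h = H + mu/K
    ([is_pressure_gradient]); a function on the plane is determined by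
    its gradient up to a constant.  The formulas of the three cases all differ from
    this one by a constant and a multiple of the first defect, which is what
    the terms in y E add up to ([pressure_form]).

    A streamline is C0 y + D e^(by) = C0 Y with Y depending on x alone, and
    w = b (Y - y) turns this into w e^w = (D b / C0) e^(bY)
    ([product_log_solution]). *)

(** * Differentiating complex functions of a real variable *)

Definition is_deriveC (f : R -> C) (t : R) (l : C) : Prop :=
  is_derive (K := R_AbsRing) (V := C_R_NormedModule) f t l.

(** Bridge between differentiability in the normed space C, the form in which
    pressures are required to be differentiable, and the componentwise
    derivatives that define [dx] and [dy]. *)
Lemma is_deriveC_components (f : R -> C) (t : R) (l : C) :
  is_deriveC f t l <->
  is_derive (fun s => Re (f s)) t (Re l) /\ is_derive (fun s => Im (f s)) t (Im l).
Proof.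
  split.
  - intros Hf; split.
    + apply (filterdiff_comp f (fun z : C_R_NormedModule => Re z) _ (fun z => Re z) Hf).
      apply filterdiff_linear, (is_linear_fst (U := R_NormedModule) (V := R_NormedModule)).
    + apply (filterdiff_comp f (fun z : C_R_NormedModule => Im z) _ (fun z => Im z) Hf).
      apply filterdiff_linear, (is_linear_snd (U := R_NormedModule) (V := R_NormedModule)).
  - intros [HR HI].
    pose proof (is_derive_plus (V := C_R_NormedModule) _ _ _ _ _
      (is_derive_scal_l (V := C_R_NormedModule) _ _ _ (1, 0)%R HR)
      (is_derive_scal_l (V := C_R_NormedModule) _ _ _ (0, 1)%R HI)) as H.
    assert (E : forall z : C, z = plus (scal (Re z : R) ((1, 0)%R : C_R_NormedModule))
                                  (scal (Im z : R) ((0, 1)%R : C_R_NormedModule))).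
    { intros [zr zi]; apply injective_projections; simpl;
        unfold plus, scal, mult; simpl; unfold mult; simpl; ring. }
    rewrite (E l).
    apply is_derive_ext with (2 := H).
    intros s; symmetry; apply E.
Qed.

Lemma is_deriveC_const (k : C) (t : R) : is_deriveC (fun _ => k) t 0.
Proof. apply (is_derive_const (V := C_R_NormedModule)). Qed.

Lemma is_deriveC_RtoC (t : R) : is_deriveC (fun s => RtoC s) t 1.
Proof.
  apply is_deriveC_components; simpl; split.
  - apply (is_derive_id (K := R_AbsRing)).
  - apply (is_derive_const (V := R_NormedModule)).
Qed.

Lemma is_deriveC_plus (f g : R -> C) (t : R) (l m : C) :
  is_deriveC f t l -> is_deriveC g t m -> is_deriveC (fun s => f s + g s) t (l + m).
Proof. apply (is_derive_plus (V := C_R_NormedModule)). Qed.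

Lemma is_deriveC_minus (f g : R -> C) (t : R) (l m : C) :
  is_deriveC f t l -> is_deriveC g t m -> is_deriveC (fun s => f s - g s) t (l - m).
Proof. apply (is_derive_minus (V := C_R_NormedModule)). Qed.

Lemma is_deriveC_mult (f g : R -> C) (t : R) (l m : C) :
  is_deriveC f t l -> is_deriveC g t m ->
  is_deriveC (fun s => f s * g s) t (l * g t + f t * m).
Proof.
  rewrite !is_deriveC_components; intros [fR fI] [gR gI].
  assert (P : forall (p q : R -> R) (p' q' : R), is_derive p t p' -> is_derive q t q' ->
    is_derive (fun s => p s * q s)%R t (p' * q t + p t * q')%R).
  { intros p q p' q' Hp Hq; apply (is_derive_mult p q t p' q' Hp Hq).
    intros; apply Rmult_comm. }
  split; unfold Re, Im in *; simpl; evar_last.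
  - apply (is_derive_minus (V := R_NormedModule)
      (fun s => fst (f s) * fst (g s))%R (fun s => snd (f s) * snd (g s))%R);
      apply P; eassumption.
  - unfold minus, plus, opp; simpl; ring.
  - apply (is_derive_plus (V := R_NormedModule)
      (fun s => fst (f s) * snd (g s))%R (fun s => snd (f s) * fst (g s))%R);
      apply P; eassumption.
  - unfold plus; simpl; ring.
Qed.

Lemma is_deriveC_cexp (f : R -> C) (t : R) (l : C) :
  is_deriveC f t l -> is_deriveC (fun s => cexp (f s)) t (l * cexp (f t)).
Proof.
  rewrite !is_deriveC_components; intros [fR fI]; unfold cexp; simpl.
  assert (P : forall (p q : R -> R) (p' q' : R), is_derive p t p' -> is_derive q t q' ->
    is_derive (fun s => exp (p s) * cos (q s))%R t
      (p' * (exp (p t) * cos (q t)) - q' * (exp (p t) * sin (q t)))%R /\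
    is_derive (fun s => exp (p s) * sin (q s))%R t
      (p' * (exp (p t) * sin (q t)) + q' * (exp (p t) * cos (q t)))%R).
  { intros p q p' q' Hp Hq.
    rewrite <- (is_derive_unique _ _ _ Hp), <- (is_derive_unique _ _ _ Hq).
    split; auto_derive; try (repeat split; eexists; eassumption);
      change (Derive (fun s => p s) t) with (Derive p t);
      change (Derive (fun s => q s) t) with (Derive q t); ring. }
  split; apply (P (fun s => Re (f s)) (fun s => Im (f s)) (Re l) (Im l) fR fI).
Qed.

Lemma dx_eq (f : field) (x y : R) (l : C) : is_deriveC (fun t => f t y) x l -> dx f x y = l.
Proof.
  rewrite is_deriveC_components; intros [HR HI]; unfold dx.
  apply injective_projections; simpl.
  - exact (is_derive_unique _ _ _ HR).
  - exact (is_derive_unique _ _ _ HI).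
Qed.

Lemma dy_eq (f : field) (x y : R) (l : C) : is_deriveC (fun t => f x t) y l -> dy f x y = l.
Proof. exact (dx_eq (fun s t => f t s) y x l). Qed.

Lemma dx_correct (f : field) (x y : R) :
  ex_derive (V := C_R_NormedModule) (fun t => f t y) x ->
  is_deriveC (fun t => f t y) x (dx f x y).
Proof. intros [l Hl]; rewrite (dx_eq _ _ _ _ Hl); exact Hl. Qed.

Lemma dy_correct (f : field) (x y : R) :
  ex_derive (V := C_R_NormedModule) (fun t => f x t) y ->
  is_deriveC (fun t => f x t) y (dy f x y).
Proof. exact (dx_correct (fun s t => f t s) y x). Qed.

Lemma zero_derivative_constant (f : R -> C) :
  (forall t, is_deriveC f t 0) -> forall s t, f s = f t.
Proof.
  intros Hf.
  assert (L : forall s t, (s < t)%R -> f s = f t).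
  { intros s t Hst; apply (eq_is_derive (V := C_R_NormedModule) f s t);
      [intros r _; apply Hf | exact Hst]. }
  intros s t; destruct (Rtotal_order s t) as [H | [-> | H]];
    [| | symmetry]; auto.
Qed.

(** Vanishing partial derivatives make the difference constant first along the
    horizontal line through (x, y), then along the vertical axis. *)
Lemma gradient_unique (f g fx fy : field) :
  (forall x y, is_deriveC (fun t => f t y) x (fx x y) /\ is_deriveC (fun t => f x t) y (fy x y)) ->
  (forall x y, is_deriveC (fun t => g t y) x (fx x y) /\ is_deriveC (fun t => g x t) y (fy x y)) ->
  forall x y, f x y = f 0%R 0%R - g 0%R 0%R + g x y.
Proof.
  intros Hf Hg x y.
  assert (X : f x y - g x y = f 0%R y - g 0%R y).
  { apply (zero_derivative_constant (fun t => f t y - g t y)); intros t.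
    replace (0 : C) with (fx t y - fx t y) by ring.
    apply is_deriveC_minus; [apply Hf | apply Hg]. }
  assert (Y : f 0%R y - g 0%R y = f 0%R 0%R - g 0%R 0%R).
  { apply (zero_derivative_constant (fun t => f 0%R t - g 0%R t)); intros t.
    replace (0 : C) with (fy 0%R t - fy 0%R t) by ring.
    apply is_deriveC_minus; [apply Hf | apply Hg]. }
  rewrite <- Y, <- X; ring.
Qed.

(** * The complex exponential and the product logarithm *)

Lemma cexp_plus (z w : C) : cexp (z + w) = cexp z * cexp w.
Proof.
  unfold cexp, Re, Im; apply injective_projections; simpl;
    rewrite exp_plus, ?cos_plus, ?sin_plus; ring.
Qed.

Lemma cexp_0 : cexp 0 = 1.
Proof.
  unfold cexp, Re, Im; apply injective_projections; simpl;
    rewrite exp_0, ?cos_0, ?sin_0; ring.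
Qed.

(** A constant exponential would have derivative a at the origin equal to 0. *)
Lemma cexp_nonconstant (a : C) : a <> 0 -> exists x : R, cexp (a * x) <> 1.
Proof.
  intros Ha; apply NNPP; intros Hconst.
  assert (E : forall x : R, cexp (a * x) = 1).
  { intros x; apply NNPP; intros Hx; apply Hconst; exists x; exact Hx. }
  assert (H0 : is_deriveC (fun x => cexp (a * x)) 0 ((0 * 0%R + a * 1) * cexp (a * 0%R))).
  { apply is_deriveC_cexp, (is_deriveC_mult (fun _ => a));
      [apply is_deriveC_const | apply is_deriveC_RtoC]. }
  apply (is_derive_ext (V := C_R_NormedModule) _ (fun _ => RtoC 1)) in H0; [|exact E].
  pose proof (dx_eq (fun _ _ => 1) 0 0 _ H0) as H1.
  rewrite (dx_eq (fun _ _ => 1) 0 0 _ (is_deriveC_const 1 0)), E in H1.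
  apply Ha; rewrite H1; ring.
Qed.

Lemma Cmult_integral (z w : C) : z * w = 0 <-> z = 0 \/ w = 0.
Proof.
  split; [|intros [-> | ->]; ring].
  intros H; apply NNPP; intros Hn.
  apply (Cmult_neq_0 z w); tauto.
Qed.

Lemma Cmult_cancel (z w : C) : z <> 0 -> z * w = 0 -> w = 0.
Proof. rewrite Cmult_integral; tauto. Qed.

(** Evaluation at the origin and at one further point on each axis suffices:
    moving in x alone isolates P + S, and then moving in y alone isolates S. *)
Lemma exponentials_independent (a b P Q S : C) : a <> 0 -> b <> 0 ->
  (forall x y : R, P * cexp (a * x) + Q * cexp (b * y)
                   + S * (cexp (a * x) * cexp (b * y)) = 0) ->
  P = 0 /\ Q = 0 /\ S = 0.
Proof.
  intros Ha Hb H.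
  destruct (cexp_nonconstant a Ha) as [x0 Hx], (cexp_nonconstant b Hb) as [y0 Hy].
  assert (Z : forall c : C, cexp (c * 0%R) = 1).
  { intros c; rewrite <- cexp_0; f_equal; ring. }
  pose proof (H 0%R 0%R) as H00; pose proof (H x0 0%R) as H10; pose proof (H 0%R y0) as H01.
  rewrite !Z in *.
  assert (PS : P + S = 0).
  { apply (Cmult_cancel (cexp (a * x0) - 1)); [apply Cminus_eq_contra, Hx|].
    transitivity (P * cexp (a * x0) + Q * 1 + S * (cexp (a * x0) * 1)
                  - (P * 1 + Q * 1 + S * (1 * 1))); [ring|].
    rewrite H00, H10; ring. }
  assert (Q0 : Q = 0).
  { transitivity (P * 1 + Q * 1 + S * (1 * 1) - (P + S)); [ring|].
    rewrite H00, PS; ring. }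
  assert (S0 : S = 0).
  { apply (Cmult_cancel (cexp (b * y0) - 1)); [apply Cminus_eq_contra, Hy|].
    transitivity (P * 1 + Q * cexp (b * y0) + S * (1 * cexp (b * y0))
                  - (P + S) - Q * cexp (b * y0)); [ring|].
    rewrite H01, PS, Q0; ring. }
  repeat split; try assumption.
  rewrite S0 in PS; rewrite <- PS; ring.
Qed.

(** The two sides correspond under w = b (Y - z). *)
Lemma product_log_solution (k d b Y z : C) : k <> 0 -> b <> 0 ->
  (k * z + d * cexp (b * z) = k * Y <->
   exists w : C, product_log (d * b / k * cexp (b * Y)) w /\ z = Y - 1 / b * w).
Proof.
  intros Hk Hb; unfold product_log; split.
  - intros H; exists (b * (Y - z)); split; [|field; exact Hb].
    assert (W : b * (Y - z) = d * b / k * cexp (b * z)).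
    { transitivity (b / k * (k * Y - k * z)); [field; exact Hk|].
      rewrite <- H; field; exact Hk. }
    rewrite W at 1; rewrite <- Cmult_assoc, <- cexp_plus.
    do 2 f_equal; ring.
  - intros [w [Hw ->]].
    assert (W : w = d * b / k * cexp (b * (Y - 1 / b * w))).
    { replace (b * (Y - 1 / b * w)) with (b * Y + - w) by (field; exact Hb).
      rewrite cexp_plus, Cmult_assoc, <- Hw, <- Cmult_assoc, <- cexp_plus.
      replace (w + - w) with (0 : C) by ring; rewrite cexp_0; ring. }
    transitivity (k * Y - k / b * w
      + k / b * (d * b / k * cexp (b * (Y - 1 / b * w)))).
    + field; split; assumption.
    + rewrite <- W; ring.
Qed.

(** Lets [deriveC] compute the derivative before it is compared with a given
    expression. *)
Lemma is_deriveC_eq (f : R -> C) (t : R) (l m : C) :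
  is_deriveC f t l -> l = m -> is_deriveC f t m.
Proof. intros H <-; exact H. Qed.

(** * Fields that are linear plus exponential in each variable *)

(** Contains the ansatz and is closed under both partial derivatives, so that
    velocity, vorticity and all iterated Laplacians are computed on the five
    coefficients. *)
Definition wave (a b k A B C0 D : C) : field := fun x y =>
  k + A * x + B * cexp (a * x) + C0 * y + D * cexp (b * y).

Lemma ansatz_wave (A B C0 D a b : C) : ansatz A B C0 D a b = wave a b 0 A B C0 D.
Proof.
  apply functional_extensionality; intros x; apply functional_extensionality; intros y.
  unfold ansatz, wave; ring.
Qed.

(** The rule is selected by the syntactic head of the function: plain
    unification would unfold [cexp] and the complex operations into pairs. *)
Ltac deriveC :=
  lazymatch goal with
  | |- is_deriveC (fun _ => ?k) _ _ => apply is_deriveC_const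
  | |- is_deriveC (fun t => RtoC t) _ _ => apply is_deriveC_RtoC
  | |- is_deriveC (fun t => @?f t + @?g t) _ _ => apply (is_deriveC_plus f g); deriveC
  | |- is_deriveC (fun t => @?f t - @?g t) _ _ => apply (is_deriveC_minus f g); deriveC
  | |- is_deriveC (fun t => @?f t * @?g t) _ _ => apply (is_deriveC_mult f g); deriveC
  | |- is_deriveC (fun t => cexp (@?f t)) _ _ => apply (is_deriveC_cexp f); deriveC
  end.

Lemma dx_wave (a b k A B C0 D : C) : dx (wave a b k A B C0 D) = wave a b A 0 (a * B) 0 0.
Proof.
  apply functional_extensionality; intros x; apply functional_extensionality; intros y.
  apply dx_eq; unfold wave; eapply is_deriveC_eq; [deriveC | ring].
Qed.

Lemma dy_wave (a b k A B C0 D : C) : dy (wave a b k A B C0 D) = wave a b C0 0 0 0 (b * D).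
Proof.
  apply functional_extensionality; intros x; apply functional_extensionality; intros y.
  apply dy_eq; unfold wave; eapply is_deriveC_eq; [deriveC | ring].
Qed.

Lemma lap_wave (a b k A B C0 D : C) :
  lap (wave a b k A B C0 D) = wave a b 0 0 (a ^ 2 * B) 0 (b ^ 2 * D).
Proof.
  apply functional_extensionality; intros x; apply functional_extensionality; intros y.
  unfold lap; rewrite dx_wave, dy_wave, dx_wave, dy_wave; unfold wave; ring.
Qed.

Lemma vel_u_wave (a b k A B C0 D : C) :
  vel_u (wave a b k A B C0 D) = wave a b C0 0 0 0 (b * D).
Proof. apply dy_wave. Qed.

Lemma vel_v_wave (a b k A B C0 D : C) :
  vel_v (wave a b k A B C0 D) = wave a b (- A) 0 (- (a * B)) 0 0.
Proof.
  apply functional_extensionality; intros x; apply functional_extensionality; intros y.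
  unfold vel_v; rewrite dx_wave; unfold wave; ring.
Qed.

Lemma vorticity_wave (a b k A B C0 D : C) :
  vorticity (wave a b k A B C0 D) = wave a b 0 0 (- (a ^ 2 * B)) 0 (- (b ^ 2 * D)).
Proof.
  apply functional_extensionality; intros x; apply functional_extensionality; intros y.
  unfold vorticity; rewrite vel_u_wave, vel_v_wave, dx_wave, dy_wave; unfold wave; ring.
Qed.

(** * The stream function equation and the three conditions *)

Definition defect_x (F : fluid) (C0 a : C) : C :=
  rho F * a * C0 - (mu F * a ^ 2 + alpha1 F * a ^ 3 * C0 - Hall F - mu F / perm F).
Definition defect_y (F : fluid) (A b : C) : C :=
  - rho F * b * A - (mu F * b ^ 2 - alpha1 F * b ^ 3 * A - Hall F - mu F / perm F).
Definition defect_xy (F : fluid) (a b : C) : C :=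
  (b ^ 2 - a ^ 2) * (rho F - alpha1 F * (a ^ 2 + b ^ 2)).

Lemma conditions_defects (F : fluid) (A C0 a b : C) :
  conditions F A C0 a b <->
  defect_x F C0 a = 0 /\ defect_y F A b = 0 /\ defect_xy F a b = 0.
Proof.
  unfold conditions, defect_x, defect_y; rewrite <- !Ceq_minus; reflexivity.
Qed.

Lemma forall_iff2 (P Q : R -> R -> Prop) :
  (forall x y, P x y <-> Q x y) -> (forall x y, P x y) <-> (forall x y, Q x y).
Proof. firstorder. Qed.

Lemma stream_equation_defects (F : fluid) (A B C0 D a b : C) :
  stream_equation F (ansatz A B C0 D a b) <->
  forall x y : R,
    a ^ 2 * B * defect_x F C0 a * cexp (a * x)
    + b ^ 2 * D * defect_y F A b * cexp (b * y)
    + - (a * b * B * D) * defect_xy F a b * (cexp (a * x) * cexp (b * y)) = 0.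
Proof.
  unfold stream_equation; rewrite ansatz_wave, !lap_wave.
  apply forall_iff2; intros x y; rewrite Ceq_minus.
  unfold jac; rewrite !dx_wave, !dy_wave; unfold wave, defect_x, defect_y, defect_xy.
  generalize (mu F / perm F); intros m.
  match goal with |- ?l = RtoC 0 <-> ?r = RtoC 0 => replace l with r by ring end.
  reflexivity.
Qed.

Lemma conditions_stream_equation (F : fluid) (A B C0 D a b : C) :
  conditions F A C0 a b -> stream_equation F (ansatz A B C0 D a b).
Proof.
  rewrite conditions_defects, stream_equation_defects.
  intros (-> & -> & ->) x y; ring.
Qed.

Lemma stream_equation_conditions (F : fluid) (A B C0 D a b : C) :
  a <> 0 -> b <> 0 -> B <> 0 -> D <> 0 ->
  stream_equation F (ansatz A B C0 D a b) -> conditions F A C0 a b.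
Proof.
  rewrite conditions_defects, stream_equation_defects.
  intros Ha Hb HB HD H.
  destruct (exponentials_independent a b _ _ _ Ha Hb H) as (H1 & H2 & H3).
  assert (Hn : - (a * b * B * D) <> 0).
  { replace (- (a * b * B * D)) with (- (1) * (a * b * B * D)) by ring.
    repeat apply Cmult_neq_0; try assumption.
    intros E; apply C1_nz; replace (1 : C) with (- - (1)) by ring; rewrite E; ring. }
  split; [|split].
  - apply (Cmult_cancel (a ^ 2 * B)); [|exact H1].
    apply Cmult_neq_0; [apply Cpow_nz|]; assumption.
  - apply (Cmult_cancel (b ^ 2 * D)); [|exact H2].
    apply Cmult_neq_0; [apply Cpow_nz|]; assumption.
  - exact (Cmult_cancel _ _ Hn H3).
Qed.

(** The defect factors as c (rho - alpha1 c^2) (k - bar F c). *)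
Lemma bar_of_condition (F : fluid) (k c : C) :
  perm F <> 0%R -> c <> 0 -> rho F - alpha1 F * c ^ 2 <> 0 ->
  (defect_x F k c = 0 <-> k = bar F c).
Proof.
  intros HK Hc HR; rewrite (Ceq_minus k).
  assert (HK' : (perm F : C) <> 0) by (intros E; apply HK, RtoC_inj, E).
  assert (E : defect_x F k c = c * (rho F - alpha1 F * c ^ 2) * (k - bar F c)).
  { unfold defect_x, bar; field; repeat split; assumption. }
  rewrite E; split.
  - apply Cmult_cancel, Cmult_neq_0; assumption.
  - intros ->; ring.
Qed.

Lemma bar_opp (F : fluid) (c : C) : perm F <> 0%R -> c <> 0 ->
  rho F - alpha1 F * c ^ 2 <> 0 -> bar F (- c) = - bar F c.
Proof.
  intros HK Hc HR.
  assert (HK' : (perm F : C) <> 0) by (intros E; apply HK, RtoC_inj, E).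
  unfold bar; replace ((- c) ^ 2) with (c ^ 2) by ring.
  field; repeat split; assumption.
Qed.

(** The second condition is the first one with (a, C0) replaced by (b, -A), so
    [bar_of_condition] solves both. *)
Lemma conditions_bar (F : fluid) (A C0 a b : C) :
  perm F <> 0%R -> a <> 0 -> b <> 0 ->
  rho F - alpha1 F * a ^ 2 <> 0 -> rho F - alpha1 F * b ^ 2 <> 0 ->
  (conditions F A C0 a b <->
   A = - bar F b /\ C0 = bar F a /\
   (b ^ 2 = a ^ 2 \/ (rho F : C) = alpha1 F * (a ^ 2 + b ^ 2))).
Proof.
  intros HK Ha Hb HRa HRb; rewrite conditions_defects.
  rewrite (bar_of_condition F C0 a HK Ha HRa).
  assert (EA : defect_y F A b = 0 <-> A = - bar F b).
  { replace (defect_y F A b) with (defect_x F (- A) b) by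
      (unfold defect_x, defect_y; generalize (mu F / perm F); intros; ring).
    rewrite (bar_of_condition F (- A) b HK Hb HRb).
    split; intros H; [rewrite <- H | rewrite H]; ring. }
  rewrite EA, (Ceq_minus (b ^ 2)), (Ceq_minus (rho F)).
  unfold defect_xy; rewrite Cmult_integral; tauto.
Qed.

(** * The pressure *)

(** The EG coefficient is a^2 (rho - alpha1 (a^2 + b^2)); the third condition
    says that it equals the symmetric one with b^2 in front, and this is
    precisely the compatibility of the two momentum equations. *)
Definition explicit_pressure (F : fluid) (A B C0 D a b : C) : field := fun x y =>
  alpha1 F * (a ^ 4 * B ^ 2 * (cexp (a * x) * cexp (a * x))
              + b ^ 4 * D ^ 2 * (cexp (b * y) * cexp (b * y)))
  + a ^ 2 * (rho F - alpha1 F * (a ^ 2 + b ^ 2)) * B * D * (cexp (a * x) * cexp (b * y))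
  - (Hall F + mu F / perm F) * (C0 * x - A * y).

Definition explicit_pressure_x (F : fluid) (B C0 D a b : C) : field := fun x y =>
  2 * alpha1 F * a ^ 5 * B ^ 2 * (cexp (a * x) * cexp (a * x))
  + a ^ 3 * (rho F - alpha1 F * (a ^ 2 + b ^ 2)) * B * D * (cexp (a * x) * cexp (b * y))
  - (Hall F + mu F / perm F) * C0.

Definition explicit_pressure_y (F : fluid) (A B D a b : C) : field := fun x y =>
  2 * alpha1 F * b ^ 5 * D ^ 2 * (cexp (b * y) * cexp (b * y))
  + a ^ 2 * b * (rho F - alpha1 F * (a ^ 2 + b ^ 2)) * B * D * (cexp (a * x) * cexp (b * y))
  + (Hall F + mu F / perm F) * A.

Lemma explicit_pressure_gradient (F : fluid) (A B C0 D a b : C) (x y : R) :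
  is_deriveC (fun t => explicit_pressure F A B C0 D a b t y) x (explicit_pressure_x F B C0 D a b x y) /\
  is_deriveC (fun t => explicit_pressure F A B C0 D a b x t) y (explicit_pressure_y F A B D a b x y).
Proof.
  unfold explicit_pressure, explicit_pressure_x, explicit_pressure_y.
  generalize (Hall F + mu F / perm F); intros h.
  split; eapply is_deriveC_eq; [deriveC | ring | deriveC | ring].
Qed.

(** The terms by which the modified pressure exceeds p, evaluated on the
    ansatz; there u does not depend on x nor v on y, so only the shear part of
    the last bracket survives. *)
Definition pressure_shift (F : fluid) (A B C0 D a b : C) : field := fun x y =>
  let E := cexp (a * x) in let G := cexp (b * y) in
  / 2 * rho F * ((C0 + b * D * G) * (C0 + b * D * G) + (A + a * B * E) * (A + a * B * E))
  - alpha1 F * ((C0 + b * D * G) * (b ^ 3 * D * G) + (A + a * B * E) * (a ^ 3 * B * E)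
                + / 2 * ((b ^ 2 * D * G - a ^ 2 * B * E) * (b ^ 2 * D * G - a ^ 2 * B * E))).

Definition pressure_shift_x (F : fluid) (A B C0 D a b : C) : field := fun x y =>
  let E := cexp (a * x) in let G := cexp (b * y) in
  rho F * (A + a * B * E) * (a ^ 2 * B * E)
  - alpha1 F * (a ^ 2 * B * E * (a ^ 3 * B * E) + (A + a * B * E) * (a ^ 4 * B * E)
                - (b ^ 2 * D * G - a ^ 2 * B * E) * (a ^ 3 * B * E)).

Definition pressure_shift_y (F : fluid) (A B C0 D a b : C) : field := fun x y =>
  let E := cexp (a * x) in let G := cexp (b * y) in
  rho F * (C0 + b * D * G) * (b ^ 2 * D * G)
  - alpha1 F * (b ^ 2 * D * G * (b ^ 3 * D * G) + (C0 + b * D * G) * (b ^ 4 * D * G)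
                + (b ^ 2 * D * G - a ^ 2 * B * E) * (b ^ 3 * D * G)).

Lemma pressure_shift_gradient (F : fluid) (A B C0 D a b : C) (x y : R) :
  is_deriveC (fun t => pressure_shift F A B C0 D a b t y) x (pressure_shift_x F A B C0 D a b x y) /\
  is_deriveC (fun t => pressure_shift F A B C0 D a b x t) y (pressure_shift_y F A B C0 D a b x y).
Proof.
  unfold pressure_shift, pressure_shift_x, pressure_shift_y.
  split; eapply is_deriveC_eq; [deriveC | field | deriveC | field].
Qed.

Lemma modified_pressure_ansatz (F : fluid) (A B C0 D a b : C) (p : field) :
  modified_pressure F (ansatz A B C0 D a b) p
  = fun x y => p x y + pressure_shift F A B C0 D a b x y.
Proof.
  apply functional_extensionality; intros x; apply functional_extensionality; intros y.
  unfold modified_pressure, pressure_shift; rewrite ansatz_wave, vel_u_wave, vel_v_wave.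
  rewrite !lap_wave, !dx_wave, !dy_wave; unfold wave; field.
Qed.

(** Each momentum equation, after subtraction of the gradient of the pressure
    shift, prescribes a partial derivative of p up to multiples of the defects:
    the x equation involves the second and third, the y equation the first. *)
Lemma is_pressure_gradient (F : fluid) (A B C0 D a b : C) (p : field) :
  conditions F A C0 a b ->
  (is_pressure F (ansatz A B C0 D a b) p <->
   forall x y : R,
   is_deriveC (fun t => p t y) x (explicit_pressure_x F B C0 D a b x y) /\
   is_deriveC (fun t => p x t) y (explicit_pressure_y F A B D a b x y)).
Proof.
  rewrite conditions_defects; intros (H1 & H2 & H3).
  unfold is_pressure; rewrite modified_pressure_ansatz, ansatz_wave, vorticity_wave,
    vel_u_wave, vel_v_wave, !lap_wave.
  apply forall_iff2; intros x y.
  assert (Qxy := pressure_shift_gradient F A B C0 D a b x y).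
  assert (X : forall l, is_deriveC (fun t => p t y) x l ->
    dx (fun x y => p x y + pressure_shift F A B C0 D a b x y) x y
    = l + pressure_shift_x F A B C0 D a b x y).
  { intros l Hl; apply dx_eq, is_deriveC_plus; [exact Hl | apply Qxy]. }
  assert (Y : forall l, is_deriveC (fun t => p x t) y l ->
    dy (fun x y => p x y + pressure_shift F A B C0 D a b x y) x y
    = l + pressure_shift_y F A B C0 D a b x y).
  { intros l Hl; apply dy_eq, is_deriveC_plus; [exact Hl | apply Qxy]. }
  assert (EX : forall l : C,
    l + pressure_shift_x F A B C0 D a b x y
    - rho F * wave a b (- A) 0 (- (a * B)) 0 0 x y
      * wave a b 0 0 (- (a ^ 2 * B)) 0 (- (b ^ 2 * D)) x y
    = mu F * wave a b 0 0 (a ^ 2 * 0) 0 (b ^ 2 * (b * D)) x y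
      - alpha1 F * wave a b (- A) 0 (- (a * B)) 0 0 x y
        * wave a b 0 0 (a ^ 2 * - (a ^ 2 * B)) 0 (b ^ 2 * - (b ^ 2 * D)) x y
      - Hall F * wave a b C0 0 0 0 (b * D) x y
      - mu F / perm F * wave a b C0 0 0 0 (b * D) x y
    <-> l = explicit_pressure_x F B C0 D a b x y).
  { intros l; rewrite Ceq_minus, (Ceq_minus l).
    (* The multiples of the defects are read off from the G and EG terms. *)
    match goal with |- ?s = _ <-> ?t = _ =>
      replace s with (t + b * D * cexp (b * y) * defect_y F A b
        - a * B * D * (cexp (a * x) * cexp (b * y)) * defect_xy F a b) end.
    - rewrite H2, H3; split; intros E; [rewrite <- E | rewrite E]; ring.
    - unfold defect_y, defect_xy, pressure_shift_x, explicit_pressure_x, wave;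
        generalize (mu F / perm F); intros m; ring. }
  assert (EY : forall l : C,
    l + pressure_shift_y F A B C0 D a b x y
    + rho F * wave a b C0 0 0 0 (b * D) x y
      * wave a b 0 0 (- (a ^ 2 * B)) 0 (- (b ^ 2 * D)) x y
    = mu F * wave a b 0 0 (a ^ 2 * - (a * B)) 0 (b ^ 2 * 0) x y
      + alpha1 F * wave a b C0 0 0 0 (b * D) x y
        * wave a b 0 0 (a ^ 2 * - (a ^ 2 * B)) 0 (b ^ 2 * - (b ^ 2 * D)) x y
      - Hall F * wave a b (- A) 0 (- (a * B)) 0 0 x y
      - mu F / perm F * wave a b (- A) 0 (- (a * B)) 0 0 x y
    <-> l = explicit_pressure_y F A B D a b x y).
  { intros l; rewrite Ceq_minus, (Ceq_minus l).
    match goal with |- ?s = _ <-> ?t = _ =>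
      replace s with (t - a * B * cexp (a * x) * defect_x F C0 a) end.
    - rewrite H1; split; intros E; [rewrite <- E | rewrite E]; ring.
    - unfold defect_x, pressure_shift_y, explicit_pressure_y, wave;
        generalize (mu F / perm F); intros m; ring. }
  split.
  - intros (Px & Py & Mx & My).
    apply dx_correct in Px; apply dy_correct in Py.
    rewrite (X _ Px), EX in Mx; rewrite (Y _ Py), EY in My.
    rewrite <- Mx, <- My; split; assumption.
  - intros [Px Py]; repeat split.
    + eexists; exact Px.
    + eexists; exact Py.
    + rewrite (X _ Px); apply EX; reflexivity.
    + rewrite (Y _ Py); apply EY; reflexivity.
Qed.

Lemma pressure_ansatz (F : fluid) (A B C0 D a b : C) (p : field) :
  conditions F A C0 a b ->
  (is_pressure F (ansatz A B C0 D a b) p <->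
   exists p0 : C, forall x y : R, p x y = p0 + explicit_pressure F A B C0 D a b x y).
Proof.
  intros Hc; rewrite (is_pressure_gradient F A B C0 D a b p Hc); split.
  - intros Hp; exists (p 0%R 0%R - explicit_pressure F A B C0 D a b 0%R 0%R).
    apply (gradient_unique _ _ _ _ Hp), explicit_pressure_gradient.
  - intros [p0 Hp] x y.
    replace p with (fun x y => p0 + explicit_pressure F A B C0 D a b x y).
    + destruct (explicit_pressure_gradient F A B C0 D a b x y) as [Hx Hy].
      split; eapply is_deriveC_eq;
        (apply is_deriveC_plus; [apply is_deriveC_const | eassumption]) || ring.
    + apply functional_extensionality; intros s; apply functional_extensionality; intros t.
      symmetry; apply Hp.
Qed.

(** The displayed pressures contain y E with the coefficient
    a B (- mu a^2 + (rho - alpha1 a^2) a C0 + H + mu/K), which is a B times the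
    first defect and hence zero; the remaining discrepancy k is absorbed in p0. *)
Lemma pressure_form (F : fluid) (A B C0 D a b : C) (p : field)
  (k : C) (disp : C -> R -> R -> C) :
  conditions F A C0 a b ->
  (forall p0 x y, disp p0 x y = p0 + k + explicit_pressure F A B C0 D a b x y
     + a * B * y * cexp (a * x) * defect_x F C0 a) ->
  (is_pressure F (ansatz A B C0 D a b) p <->
   exists p0 : C, forall x y : R, p x y = disp p0 x y).
Proof.
  intros Hc Hd; rewrite (pressure_ansatz F A B C0 D a b p Hc).
  apply conditions_defects in Hc; destruct Hc as [H1 _].
  split; intros [p0 Hp].
  - exists (p0 - k); intros x y; rewrite Hp, Hd, H1; ring.
  - exists (p0 + k); intros x y; rewrite Hp, Hd, H1; ring.
Qed.

(** * Streamlines and velocities *)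

(** [K], [Z] and [disp] leave room for the various equivalent ways of writing
    the prefactor, the exponent and the resulting y. *)
Lemma streamline_form (A B C0 D a b K Z Omega : C) (x y : R) (disp : C -> C) :
  C0 <> 0 -> b <> 0 ->
  K = D * b / C0 -> Z = b * ((Omega - A * x - B * cexp (a * x)) / C0) ->
  (forall w, disp w = (Omega - A * x - B * cexp (a * x)) / C0 - 1 / b * w) ->
  (ansatz A B C0 D a b x y = Omega <->
   exists w : C, product_log (K * cexp Z) w /\ (y : C) = disp w).
Proof.
  intros HC Hb -> -> Hd.
  transitivity (C0 * y + D * cexp (b * y) = C0 * ((Omega - A * x - B * cexp (a * x)) / C0)).
  - rewrite Ceq_minus, (Ceq_minus (C0 * y + _)).
    match goal with |- ?l = RtoC 0 <-> ?r = RtoC 0 => replace l with r; [reflexivity|] end.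
    unfold ansatz; field; exact HC.
  - rewrite (product_log_solution C0 D b _ y HC Hb).
    split; intros [w [Hw Hy]]; exists w; split; try exact Hw; rewrite Hy, Hd; reflexivity.
Qed.

Lemma vel_u_ansatz (A B C0 D a b : C) (x y : R) :
  vel_u (ansatz A B C0 D a b) x y = C0 + D * b * cexp (b * y).
Proof. rewrite ansatz_wave, vel_u_wave; unfold wave; ring. Qed.

Lemma vel_v_ansatz (A B C0 D a b : C) (x y : R) :
  vel_v (ansatz A B C0 D a b) x y = - A - B * a * cexp (a * x).
Proof. rewrite ansatz_wave, vel_v_wave; unfold wave; ring. Qed.

(** * The three families of solutions *)

Theorem mainTheorem1 (F : fluid) (A B C0 D a b : C)
  (hmu : (0 <= mu F)%R) (hK : perm F <> 0%R)
  (ha : a <> 0) (hb : b <> 0)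
  (hra : rho F - alpha1 F * a ^ 2 <> 0)
  (hrb : rho F - alpha1 F * b ^ 2 <> 0) :
  let psi := ansatz A B C0 D a b in
  let h := Hall F + mu F / perm F in
  (* substitution into the stream function equation *)
  (conditions F A C0 a b -> stream_equation F psi) /\
  (B <> 0 -> D <> 0 -> stream_equation F psi -> conditions F A C0 a b) /\
  (conditions F A C0 a b <->
     A = - bar F b /\ C0 = bar F a /\
     (b ^ 2 = a ^ 2 \/ (rho F : C) = alpha1 F * (a ^ 2 + b ^ 2))) /\
  (* Case 1 *)
  (conditions F A C0 a b -> b = a ->
   (rho F : C) <> alpha1 F * (a ^ 2 + b ^ 2) ->
   (forall x y : R,
      psi x y = bar F a * (y - x) + B * cexp (a * x) + D * cexp (a * y)) /\
   (forall x y : R, vel_u psi x y = bar F a + D * a * cexp (a * y)) /\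
   (forall x y : R, vel_v psi x y = bar F a - B * a * cexp (a * x)) /\
   (forall p : field, is_pressure F psi p <->
      exists p0 : C, forall x y : R,
      p x y = p0 - rho F * bar F a ^ 2 - mu F * B * a ^ 3 * y * cexp (a * x)
        + (rho F - alpha1 F * a ^ 2)
          * (a ^ 2 * bar F a * B * y * cexp (a * x)
             + a ^ 2 * D * B * cexp (a * (x + y)))
        + alpha1 F
          * (B ^ 2 * a ^ 4 * cexp (2 * a * x) + D ^ 2 * a ^ 4 * cexp (2 * a * y)
             - D * B * a ^ 4 * cexp (a * (x + y)))
        - h * (bar F a * x + bar F a * y - B * a * y * cexp (a * x))) /\
   (bar F a <> 0 -> forall (Omega : C) (x y : R), psi x y = Omega <->
      exists w : C,
      product_log
        (D * a / bar F a
         * cexp (a * (- B * cexp (a * x) + bar F a * x + Omega) / bar F a)) w /\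
      (y : C) = (- B * cexp (a * x) + bar F a * x + Omega) / bar F a
                - 1 / a * w)) /\
  (* Case 2 *)
  (conditions F A C0 a b -> b = - a ->
   (rho F : C) <> alpha1 F * (a ^ 2 + b ^ 2) ->
   (forall x y : R,
      psi x y = bar F a * (y + x) + B * cexp (a * x) + D * cexp (- a * y)) /\
   (forall x y : R, vel_u psi x y = bar F a - D * a * cexp (- a * y)) /\
   (forall x y : R, vel_v psi x y = - bar F a - B * a * cexp (a * x)) /\
   (forall p : field, is_pressure F psi p <->
      exists p0 : C, forall x y : R,
      p x y = p0 - rho F * bar F a ^ 2 - mu F * B * a ^ 3 * y * cexp (a * x)
        + (rho F - alpha1 F * a ^ 2)
          * (a ^ 2 * bar F a * B * y * cexp (a * x)
             + a ^ 2 * D * B * cexp (a * (x - y)))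
        + alpha1 F
          * (B ^ 2 * a ^ 4 * cexp (2 * a * x)
             + D ^ 2 * a ^ 4 * cexp (- (2) * a * y)
             - D * B * a ^ 4 * cexp (a * (x - y)))
        - h * (bar F a * x - bar F a * y - B * a * y * cexp (a * x))) /\
   (bar F a <> 0 -> forall (Omega : C) (x y : R), psi x y = Omega <->
      exists w : C,
      product_log
        (- (D * a / bar F a)
         * cexp (a * (B * cexp (a * x) + bar F a * x - Omega) / bar F a)) w /\
      (y : C) = (- B * cexp (a * x) - bar F a * x + Omega) / bar F a
                + 1 / a * w)) /\
  (* Case 3 *)
  (conditions F A C0 a b -> b ^ 2 - a ^ 2 <> 0 ->
   (rho F : C) = alpha1 F * (a ^ 2 + b ^ 2) /\
   (forall x y : R,
      psi x y = - bar F b * x + bar F a * y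
                + B * cexp (a * x) + D * cexp (b * y)) /\
   (forall x y : R, vel_u psi x y = bar F a + D * b * cexp (b * y)) /\
   (forall x y : R, vel_v psi x y = bar F b - B * a * cexp (a * x)) /\
   (forall p : field, is_pressure F psi p <->
      exists p0 : C, forall x y : R,
      p x y = p0 - / 2 * rho F * (bar F a ^ 2 + bar F b ^ 2)
        - mu F * B * a ^ 3 * y * cexp (a * x)
        + (rho F - alpha1 F * a ^ 2)
          * (a ^ 2 * bar F a * B * y * cexp (a * x)
             + a ^ 2 * D * B * cexp (a * x + b * y))
        + alpha1 F
          * (B ^ 2 * a ^ 4 * cexp (2 * a * x) + D ^ 2 * b ^ 4 * cexp (2 * b * y)
             - D * B * a ^ 2 * b ^ 2 * cexp (a * x + b * y))
        - h * (bar F a * x + bar F b * y - B * a * y * cexp (a * x))) /\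
   (bar F a <> 0 -> forall (Omega : C) (x y : R), psi x y = Omega <->
      exists w : C,
      product_log
        (D * b / bar F a
         * cexp (- b * (B * cexp (a * x) - bar F b * x - Omega) / bar F a)) w /\
      (y : C) = - ((B * cexp (a * x) - bar F b * x - Omega) / bar F a)
                - 1 / b * w) /\
   (forall x y : R,
      psi x y = - bar F b * x
        + y / (alpha1 F * b ^ 2)
          * (mu F * a - Hall F / a - mu F / (perm F * a))
        + B * cexp (a * x) + D * cexp (b * y)) /\
   (forall x y : R,
      psi x y = - (x / (alpha1 F * a ^ 2)
          * (mu F * b - Hall F / b - mu F / (perm F * b)))
        + bar F a * y + B * cexp (a * x) + D * cexp (b * y))).
Proof.
  cbv zeta.
  split; [apply conditions_stream_equation|].
  split; [intros HB HD; apply stream_equation_conditions; assumption|].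
  split; [apply conditions_bar; assumption|].
  assert (Hbar : conditions F A C0 a b -> A = - bar F b /\ C0 = bar F a).
  { intros Hc; apply conditions_bar in Hc; tauto. }
  assert (double : forall c z : C, cexp (2 * c * z) = cexp (c * z) * cexp (c * z)).
  { intros c z; rewrite <- cexp_plus; f_equal; ring. }
  split; [|split].
  - intros Hc -> _; destruct (Hbar Hc) as [HA HC].
    rewrite <- HC in HA |- *.
    split; [|split; [|split; [|split]]].
    + intros x y; unfold ansatz; rewrite HA; ring.
    + intros x y; apply vel_u_ansatz.
    + intros x y; rewrite vel_v_ansatz, HA; ring.
    + intros p; apply pressure_form with (k := - rho F * C0 ^ 2); [exact Hc|].
      intros p0 x y.
      replace (a * (x + y)) with (a * x + a * y) by ring.
      rewrite !double, cexp_plus.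
      unfold explicit_pressure, defect_x; rewrite HA; generalize (mu F / perm F); intros m; ring.
    + intros HC0 Omega x y; apply streamline_form; try assumption.
      * reflexivity.
      * rewrite HA; field; assumption.
      * intros w; rewrite HA; field; split; assumption.
  - intros Hc -> _; destruct (Hbar Hc) as [HA HC].
    rewrite bar_opp in HA by assumption.
    rewrite <- HC in HA |- *.
    assert (HA' : A = C0) by (rewrite HA; ring).
    split; [|split; [|split; [|split]]].
    + intros x y; unfold ansatz; rewrite HA'; ring.
    + intros x y; rewrite vel_u_ansatz; ring.
    + intros x y; rewrite vel_v_ansatz, HA'; ring.
    + intros p; apply pressure_form with (k := - rho F * C0 ^ 2); [exact Hc|].
      intros p0 x y.
      replace (- (2) * a * y) with (2 * - a * y) by ring.
      replace (a * (x - y)) with (a * x + - a * y) by ring.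
      rewrite !double, cexp_plus.
      unfold explicit_pressure, defect_x; rewrite HA'; generalize (mu F / perm F); intros m; ring.
    + intros HC0 Omega x y; apply streamline_form; try assumption.
      * field; assumption.
      * rewrite HA'; field; assumption.
      * intros w; rewrite HA'; field; split; assumption.
  - intros Hc Hab; destruct (Hbar Hc) as [HA HC].
    assert (Hr : (rho F : C) = alpha1 F * (a ^ 2 + b ^ 2)).
    { apply Ceq_minus, (Cmult_cancel (b ^ 2 - a ^ 2)); [exact Hab | apply Hc]. }
    assert (HA' : bar F b = - A) by (rewrite HA; ring).
    split; [exact Hr|].
    split; [|split; [|split; [|split; [|split; [|split]]]]].
    + intros x y; unfold ansatz; rewrite HA, HC; ring.
    + intros x y; rewrite vel_u_ansatz, HC; ring.
    + intros x y; rewrite vel_v_ansatz, HA; ring.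
    + rewrite HA', <- HC; intros p.
      apply pressure_form with (k := - / 2 * rho F * (C0 ^ 2 + A ^ 2)); [exact Hc|].
      intros p0 x y; rewrite !double, cexp_plus.
      unfold explicit_pressure, defect_x; generalize (mu F / perm F); intros m; field.
    + rewrite HA', <- HC; intros HC0 Omega x y; apply streamline_form; try assumption.
      * reflexivity.
      * field; assumption.
      * intros w; field; split; assumption.
    + intros x y.
      (* Here rho = alpha1 (a^2 + b^2), so alpha1 b^2 is the denominator of bar F a. *)
      replace (alpha1 F * b ^ 2) with (rho F - alpha1 F * a ^ 2) by (rewrite Hr; ring).
      unfold ansatz; rewrite HA, HC; unfold bar at 2, Cdiv; ring.
    + intros x y.
      replace (alpha1 F * a ^ 2) with (rho F - alpha1 F * b ^ 2) by (rewrite Hr; ring).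
      unfold ansatz; rewrite HA, HC; unfold bar at 1, Cdiv; ring.
Qed.
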